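(* The class $\mathcal{D}^-$ has the following properties. (a) If $X_n\in\mathcal{D}^-$ for all $n\in\mathbb{N}$ and $X_n$ converges in distribution to $X$, then $X\in\mathcal{D}^-$. (b) If $X\in\mathcal{D}^-$ is non-degenerate (not almost surely constant), then $E|X|=\infty$. (c) If $X\in\mathcal{D}^-$, then $aX+b\in\mathcal{D}^-$ for all $a>0$ and $b\in\mathbb{R}$. (d) If $X,Y\in\mathcal{D}^-$ are independent, then $X+Y\in\mathcal{D}^-$. (e) If $X,Y\in\mathcal{D}^-$ are independent, then $\max\{X,Y\}\in\mathcal{D}^-$. (f) If $X\in\mathcal{D}^-$ and $\phi:\mathbb{R}\to\mathbb{R}$ is non-decreasing and convex, then $\phi(X)\in\mathcal{D}^-$.
   Context: For real random variables, $X \le_{st} Y$ means $P(X\le t)\ge P(Y\le t)$ for all $t\in\mathbb{R}$. A real random variable $X$ (equivalently its distribution function $F_X$) belongs to $\mathcal{D}^-$ if for every $n\in\mathbb{N}$, all $\theta_1,\dots,\theta_n\ge 0$ with $\sum_{i=1}^n\theta_i=1$, and i.i.d. random variables $X_1,\dots,X_n$ with distribution $F_X$, we have $X_1\le_{st}\sum_{i=1}^n\theta_iX_i$. *)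

(* Defs.v *)
From HB Require Import structures.
From mathcomp Require Import all_boot all_order all_algebra.
From mathcomp Require Import all_classical all_reals all_analysis.
Set Implicit Arguments. Unset Strict Implicit. Unset Printing Implicit Defensive.
Import Order.TTheory GRing.Theory Num.Theory.
Import numFieldNormedType.Exports.
Local Open Scope classical_set_scope.
Local Open Scope ring_scope.

Definition distfun (R : realType) (mu : probability R R) (t : R) : R :=
  fine (mu [set x : R | x <= t]).

Definition mutually_independent (R : realType) (d : measure_display)
    (T : measurableType d) (P : probability T R) (n : nat)
    (X : 'I_n -> {RV P >-> R}) : Prop :=
  forall B : 'I_n -> set R, (forall i, measurable (B i)) ->
    P (\bigcap_(i in [set: 'I_n]) (X i @^-1` B i)) =
    (\prod_(i < n) P (X i @^-1` B i))%E.

Definition independent2 (R : realType) (d : measure_display)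
    (T : measurableType d) (P : probability T R) (X Y : {RV P >-> R}) : Prop :=
  forall A B : set R, measurable A -> measurable B ->
    P (X @^-1` A `&` Y @^-1` B) = (P (X @^-1` A) * P (Y @^-1` B))%E.

Definition iid_with (R : realType) (d : measure_display)
    (T : measurableType d) (P : probability T R) (n : nat)
    (X : 'I_n -> {RV P >-> R}) (mu : probability R R) : Prop :=
  mutually_independent X /\
  forall i (A : set R), measurable A -> P (X i @^-1` A) = mu A.

(* The class D^- (as a property of a distribution on R).
   Indices are 'I_n.+1, i.e. every number n+1 >= 1 of summands. *)
Definition Dminus (R : realType) (mu : probability R R) : Prop :=
  forall (n : nat) (theta : 'I_n.+1 -> R),
    (forall i, 0 <= theta i) -> \sum_(i < n.+1) theta i = 1 ->
    forall (d : measure_display) (T : measurableType d) (P : probability T R)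
      (X : 'I_n.+1 -> {RV P >-> R}),
      iid_with X mu ->
      (* X_1 <=_st sum_i theta_i X_i *)
      forall t : R,
        (P [set w | (\sum_(i < n.+1) theta i * X i w <= t)%R] <=
         P [set w | (X ord0 w <= t)%R])%E.

Definition cvg_in_distribution (R : realType) (mu_ : nat -> probability R R)
    (mu : probability R R) : Prop :=
  forall t : R, {for t, continuous (distfun mu)} ->
    (fun k => distfun (mu_ k) t) @ \oo --> distfun mu t.

(* Main.v *)
Require Import Defs.
From HB Require Import structures.
From mathcomp Require Import all_boot all_order all_algebra.
From mathcomp Require Import all_classical all_reals all_analysis.
From mathcomp Require Import measurable_realfun ring lra.
Set Implicit Arguments. Unset Strict Implicit. Unset Printing Implicit Defensive.
Import Order.TTheory GRing.Theory Num.Theory.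
Import numFieldNormedType.Exports.
Local Open Scope classical_set_scope.
Local Open Scope ring_scope.

(** The law of [\sum_i theta_i X_i] is determined by the law of the i.i.d. [X_i],
so membership in the class can be tested on any one i.i.d. family, chosen to suit
each closure property. For (d) and (e), take two families on the two factors of
a product space: the weighted sum of [X_i + Y_i] is compared with [X_1 + Y_1] by
two applications of Fubini, and that of [max(X_i, Y_i)] dominates the maximum of
the two weighted sums. For (f), Jensen reduces the claim to the lower set
[{phi <= t}]; (c) is an affine instance. For (a), the inequality
"[P(S < t) <= liminf P(S_k < t)] for all [t]" passes from summands to weighted
sums, by the layer-cake formula and Fatou's lemma. For (b), if the mean is finite
then for every [c] the convex function [x |-> max(x - c, 0)] has the same finite
mean at [X_1] and at [(X_1 + X_2) / 2], so the equality case of convexity gives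
[P(X_1 < c < X_2) = 0] and the law is degenerate. *)

Local Notation Iic t := [set x | (x <= t)%R].
Local Notation Iio t := [set x | (x < t)%R].
Local Notation Ioi t := [set x | (t < x)%R].

(** * Product probabilities and uniqueness on rectangles *)

Section product_probability.
Context d1 d2 (T1 : measurableType d1) (T2 : measurableType d2) (R : realType)
  (P1 : probability T1 R) (P2 : probability T2 R).

Definition prodP : probability (T1 * T2)%type R :=
  [the probability _ _ of (P1 \x P2)%E].

Lemma prodPE (A : set T1) (B : set T2) : measurable A -> measurable B ->
  prodP (A `*` B) = (P1 A * P2 B)%E.
Proof. exact: product_measure1E. Qed.

(** Integrate the inequality between sections. This lemma and its mirror image let one coordinate be
    replaced while the other is frozen. *)
Lemma prodP_le_xsection (A B : set (T1 * T2)) : measurable A -> measurable B ->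
  (forall x, (P2 (xsection A x) <= P2 (xsection B x))%E) ->
  (prodP A <= prodP B)%E.
Proof.
move=> mA mB AB; apply: ge0_le_integral => //=.
- exact: measurable_fun_xsection.
- exact: measurable_fun_xsection.
Qed.

Lemma prodP_le_ysection (A B : set (T1 * T2)) : measurable A -> measurable B ->
  (forall y, (P1 (ysection A y) <= P1 (ysection B y))%E) ->
  (prodP A <= prodP B)%E.
Proof.
move=> mA mB AB.
(* [\x] integrates the measures of [x]-sections; uniqueness of the product measure gives the other
   order of integration. *)
have E C : measurable C -> prodP C = (P1 \x^ P2)%E C.
  by move=> mC; apply: product_measure_unique => // ? ? ? ?;
    exact: product_measure2E.
rewrite !E//; apply: ge0_le_integral => //=.
- exact: measurable_fun_ysection.
- exact: measurable_fun_ysection.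
Qed.

End product_probability.

Section rectangles.
Context d d1 d2 (T : measurableType d) (T1 : measurableType d1)
  (T2 : measurableType d2) (R : realType).

(** Rectangles form a generating class stable under intersection and containing the whole space,
    where [m1] is finite. *)
Lemma rectangles_unique (m1 m2 : {measure set (T1 * T2) -> \bar R}) :
  (m1 setT < +oo)%E ->
  (forall A B, measurable A -> measurable B -> m1 (A `*` B) = m2 (A `*` B)) ->
  forall C, measurable C -> m1 C = m2 C.
Proof.
move=> m1fin m12 C mC.
pose G := [set A `*` B | A in measurable & B in measurable] : set (set (T1 * T2)).
apply: (measure_unique G (fun=> setT)) => //.
- exact: measurable_prod_measurableType.
- move=> _ _ [A1 mA1 [B1 mB1 <-]] [A2 mA2 [B2 mB2 <-]].
  rewrite -setXI; exists (A1 `&` A2); first exact: measurableI.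
  by exists (B1 `&` B2) => //; exact: measurableI.
- by move=> _; exists setT => //; exists setT => //; rewrite setXTT.
- by rewrite bigcup_const.
- by move=> _ [A mA [B mB <-]]; exact: m12.
Qed.

(** As functions of [C], both sides are finite measures that agree on rectangles. Carrying the event
    [E] along yields the law of [V] and its independence of [E] together. *)
Lemma product_law (P : probability T R) (V : {mfun T >-> (T1 * T2)%type})
    (E : set T) (m1 : probability T1 R) (m2 : probability T2 R) :
  measurable E ->
  (forall A B, measurable A -> measurable B ->
     P (V @^-1` (A `*` B) `&` E) = (m1 A * m2 B * P E)%E) ->
  forall C, measurable C -> P (V @^-1` C `&` E) = (prodP m1 m2 C * P E)%E.
Proof.
move=> mE VE C mC.
have PE0 : 0 <= fine (P E) by rewrite fine_ge0.
have -> : (prodP m1 m2 C * P E)%E = mscale (NngNum PE0) (prodP m1 m2) C.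
  by rewrite /mscale/= fineK ?fin_num_measure// muleC.
transitivity (pushforward (mrestr P mE) V C); first by [].
apply: rectangles_unique => //.
  rewrite /= /pushforward /mrestr/= (le_lt_trans (probability_le1 _ _)) ?ltry//.
  by apply: measurableI => //; exact: measurable_funPTI.
move=> A B mA mB.
rewrite /= /pushforward /mrestr/= /mscale/= fineK ?fin_num_measure// prodPE//.
by rewrite muleC -VE// muleC.
Qed.

End rectangles.

(** * Laws of weighted sums *)

Definition mfun_of d d' (T : measurableType d) (T' : measurableType d')
    (f : T -> T') (mf : measurable_fun setT f) : {mfun T >-> T'} :=
  HB.pack f (isMeasurableFun.Build d d' T T' f mf).

Section iid.
Context (R : realType) (mu : probability R R).

(** By induction, multiply the space by a copy of [R] under [mu]. The new coordinate gets index
    [ord0], and the old variables move along [lift ord0]. *)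
Lemma iid_exists n : exists (d : measure_display) (T : measurableType d)
  (P : probability T R) (X : 'I_n -> {RV P >-> R}), iid_with X mu.
Proof.
elim: n => [|n [d [T [P [X [indX lawX]]]]]].
  exists _, R, mu, (fun=> mfun_of (@measurable_id _ _ _)).
  split=> [B mB|[]//].
  by rewrite big_ord0 (_ : \bigcap_(_ in _) _ = setT) ?probability_setT//;
     apply/seteqP; split=> // x _ [].
pose f i (w : T * R) : R := if unlift ord0 i is Some j then X j w.1 else w.2.
have mf i : measurable_fun setT (f i).
  rewrite /f; case: unlift => [j|]; last exact: measurable_snd.
  by apply: measurableT_comp; [exact: measurable_funPT|exact: measurable_fst].
have f0 B : f ord0 @^-1` B = setT `*` B.
  by apply/seteqP; split=> -[x y]; rewrite /= /f unlift_none//= => -[].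
have fl j B : f (lift ord0 j) @^-1` B = (X j @^-1` B) `*` setT.
  by apply/seteqP; split=> -[x y]; rewrite /= /f liftK//= => -[].
have lawf i (A : set R) : measurable A -> prodP P mu (f i @^-1` A) = mu A.
  move=> mA; case: (unliftP ord0 i) => [j|] ->.
    by rewrite fl prodPE// ?probability_setT ?mule1 ?lawX//;
      exact: measurable_funPTI.
  by rewrite f0 prodPE// probability_setT mul1e.
exists _, (T * R)%type, (prodP P mu), (fun i => mfun_of (mf i)).
split=> [B mB|i A mA]; last exact: lawf.
rewrite big_ord_recl.
transitivity (mu (B ord0) * \prod_(j < n) P (X j @^-1` B (lift ord0 j)))%E;
  last first.
  congr (_ * _)%E; first by rewrite -(lawf ord0).
  by apply: eq_bigr => j _; rewrite lawX// -(lawf (lift ord0 j)).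
rewrite -indX// muleC -prodPE//; last first.
  by apply: fin_bigcap_measurable => // j _; exact: measurable_funPTI.
congr (prodP _ _ _); apply/seteqP; split=> [[x y] h|[x y] [/= h hy] i _].
  split=> [j _|]; last by have := h ord0 I; rewrite /= /f unlift_none.
  by have := h (lift ord0 j) I; rewrite /= /f liftK.
case: (unliftP ord0 i) => [j|] -> /=; last by rewrite /f unlift_none.
by rewrite /f liftK; exact: h.
Qed.

Lemma measurable_shift (c : R) :
  measurable_fun setT (fun p : R * R => p.1 + c * p.2).
Proof.
apply: measurable_funD; first exact: measurable_fst.
by apply: measurable_funM => //; exact: measurable_snd.
Qed.

(* The law of [\sum_(i < m) theta i * X_i] for i.i.d. [X_i] of law [mu]. *)
Fixpoint wsum (theta : nat -> R) (m : nat) : probability R R :=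
  if m is m'.+1 then
    distribution (prodP (wsum theta m') mu) (mfun_of (measurable_shift (theta m')))
  else [the probability R R of \d_(0 : R)].

Context d (T : measurableType d) (P : probability T R) (n : nat)
  (X : 'I_n -> {RV P >-> R}) (theta : nat -> R).

(** The index type stays ['I_n] for every [m], so that an induction on [m] keeps a single family
    [X]. *)
Definition partial_sum m (w : T) := \sum_(i < n | (i < m)%N) theta i * X i w.

Lemma measurable_partial_sum m : measurable_fun setT (partial_sum m).
Proof.
rewrite /partial_sum; under eq_fun do rewrite big_mkcond.
apply: measurable_sum => i; case: (i < m)%N => //.
by apply: measurable_funM => //; exact: measurable_funPT.
Qed.

Lemma partial_sumS m (w : T) (mn : (m < n)%N) :
  partial_sum m.+1 w = partial_sum m w + theta m * X (Ordinal mn) w.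
Proof.
rewrite /partial_sum (bigD1 (Ordinal mn))//= addrC; congr (_ + _).
by apply: eq_bigl => i; rewrite ltnS -val_eqE/= andbC ltn_neqAle.
Qed.

(** Constraints on the variables of index at least [m] are included so that the induction also
    carries the independence of the partial sum from them. In the step, the pair of the partial sum
    and the next variable has a product law on [E], which [wsum] pushes forward. *)
Lemma partial_sum_law m : iid_with X mu -> (m <= n)%N ->
  forall (A : set R) (B : 'I_n -> set R), measurable A ->
    (forall i, measurable (B i)) -> (forall i : 'I_n, (i < m)%N -> B i = setT) ->
  P (partial_sum m @^-1` A `&` \bigcap_(i in [set: 'I_n]) (X i @^-1` B i)) =
  (wsum theta m A * P (\bigcap_(i in [set: 'I_n]) (X i @^-1` B i)))%E.
Proof.
move=> [indX lawX]; elim: m => [_|m IH mn] A B mA mB BT.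
  rewrite /= diracE.
  have -> : partial_sum 0 = cst 0.
    by apply/funext => w; rewrite /partial_sum big_pred0.
  by rewrite preimage_cst; case: ifPn => A0;
    rewrite ?setTI ?mul1e ?set0I ?measure0 ?mul0e.
set E := \bigcap_(i in _) _.
have mE : measurable E.
  by apply: fin_bigcap_measurable => // i _; exact: measurable_funPTI.
pose V := mfun_of (measurable_fun_pair (measurable_partial_sum m)
  (@measurable_funPT _ _ _ _ (X (Ordinal mn)))).
pose C := (fun p : R * R => p.1 + theta m * p.2) @^-1` A.
have -> : partial_sum m.+1 @^-1` A = V @^-1` C.
  by apply/seteqP; split=> w; rewrite /C /preimage/= (partial_sumS _ mn).
have mC : measurable C by rewrite -[C]setTI; exact: measurable_shift.
rewrite (@product_law _ _ _ _ _ _ _ P V E (wsum theta m) mu)// => A' B' mA' mB'.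
(* The constraint at index [m] is trivial in [B]; putting [B'] there turns a rectangle for [V] into
   an instance of the induction hypothesis. *)
pose B'' i := if i == Ordinal mn then B' else B i.
have mB'' i : measurable (B'' i) by rewrite /B''; case: ifP.
have EB : \bigcap_(i in [set: 'I_n]) (X i @^-1` B'' i) =
  X (Ordinal mn) @^-1` B' `&` E.
  apply/seteqP; split=> [w h|w [h1 h2] i _].
    split; first by have := h (Ordinal mn) I; rewrite /B'' eqxx.
    move=> i _; have := h i I; rewrite /B''; case: eqP => [->|//] _.
    by rewrite BT.
  by rewrite /B''; case: eqP => [->//|_]; exact: h2.
have -> : V @^-1` (A' `*` B') `&` E = partial_sum m @^-1` A' `&`
    \bigcap_(i in [set: 'I_n]) (X i @^-1` B'' i).
  by rewrite EB setIA.
rewrite IH//; last 2 first.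
- exact: ltnW.
- move=> i im; rewrite /B''; case: eqP => [eim|_].
    by rewrite eim/= ltnn in im.
  by apply: BT; exact: ltnW.
rewrite -muleA; congr (_ * _)%E.
rewrite !indX// (bigD1 (Ordinal mn))//= [in RHS](bigD1 (Ordinal mn))//=.
rewrite /B'' eqxx !lawX// BT//= probability_setT mul1e; congr (_ * _)%E.
by apply: eq_bigr => i /negbTE ->.
Qed.

Lemma sum_law (A : set R) : iid_with X mu -> measurable A ->
  P [set w | A (\sum_(i < n) theta i * X i w)] = wsum theta n A.
Proof.
move=> iidX mA.
have := partial_sum_law iidX (leqnn n) mA (fun=> measurableT) (fun _ _ => erefl).
rewrite [\bigcap_(_ in _) _](_ : _ = setT); last by apply/seteqP; split.
rewrite setIT probability_setT mule1 => <-.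
congr (P _); rewrite (_ : partial_sum n = fun w => \sum_(i < n) theta i * X i w)//.
by apply/funext => w; apply: eq_bigl => i; rewrite ltn_ord.
Qed.

End iid.

Section law_of_sums.
Context (R : realType).

(** [inord] extends the weights to all of [nat]; [wsum] at [n.+1] reads only indices up to [n],
    where [inord] inverts the coercion. *)
Lemma iid_sum_law (mu : probability R R) d (T : measurableType d)
    (P : probability T R) n (X : 'I_n.+1 -> {RV P >-> R}) (theta : 'I_n.+1 -> R)
    (A : set R) :
  iid_with X mu -> measurable A ->
  P [set w | A (\sum_(i < n.+1) theta i * X i w)] = wsum mu (theta \o inord) n.+1 A.
Proof.
move=> iidX mA; rewrite -(sum_law (theta \o inord) iidX mA); congr (P _).
have E w : \sum_(i < n.+1) (theta \o inord) i * X i w =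
  \sum_(i < n.+1) theta i * X i w.
  by apply: eq_bigr => i _; rewrite /= inord_val.
by apply/seteqP; split=> w; rewrite /= E.
Qed.

(** Both probabilities depend on the family only through [mu], so for each choice of weights one
    i.i.d. family suffices. *)
Lemma Dminus_intro (mu : probability R R) :
  (forall n (theta : 'I_n.+1 -> R), (forall i, 0 <= theta i) ->
    \sum_(i < n.+1) theta i = 1 ->
    exists (d : measure_display) (T : measurableType d) (P : probability T R)
      (X : 'I_n.+1 -> {RV P >-> R}), iid_with X mu /\
    forall t, (P [set w | (\sum_(i < n.+1) theta i * X i w <= t)%R] <=
               P [set w | (X ord0 w <= t)%R])%E) -> Dminus mu.
Proof.
move=> H n theta th0 th1 d T P X iidX t.
have [d' [T' [P' [X' [iidX' H']]]]] := H n theta th0 th1.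
have mt : measurable (Iic t) by rewrite -set_itvNyc.
rewrite (iid_sum_law theta iidX mt) -(iid_sum_law theta iidX' mt).
apply: (le_trans (H' t)).
by rewrite [leLHS](iidX'.2 ord0 _ mt) [leRHS](iidX.2 ord0 _ mt).
Qed.

Lemma wsum_Dminus (mu : probability R R) n (theta : 'I_n.+1 -> R) (t : R) :
  Dminus mu -> (forall i, 0 <= theta i) -> \sum_(i < n.+1) theta i = 1 ->
  (wsum mu (theta \o inord) n.+1 (Iic t) <= mu (Iic t))%E.
Proof.
move=> Dmu th0 th1; have mt : measurable (Iic t) by rewrite -set_itvNyc.
have [d [T [P [X iidX]]]] := iid_exists mu n.+1.
rewrite -(iid_sum_law theta iidX mt); have [_ lX] := iidX.
by rewrite -(lX ord0 _ mt); exact: Dmu.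
Qed.

(** * Lower sets and their approximation by closed half-lines *)

Definition lower_set (L : set R) := forall x y, x <= y -> L y -> L x.

Lemma measurable_lower_set L : lower_set L -> measurable L.
Proof.
move=> lL; apply: is_interval_measurable => x y _ Ly z /andP[_ zy].
exact: lL Ly.
Qed.

(** If [L] has a maximum, take it constantly; if [L] is unbounded above, it is the whole line and
    [n] works; otherwise approach the supremum, which is not attained. *)
Lemma lower_set_bigcup (L : set R) : lower_set L -> L !=set0 ->
  exists a : nat -> R, [/\ nondecreasing_seq a, forall n, L (a n) &
    L = \bigcup_n (Iic (a n))].
Proof.
move=> lL [x0 Lx0].
have [[s Ls sub]|nomax] := pselect (exists2 s, L s & ubound L s).
  exists (fun=> s); split=> //; apply/seteqP; split=> [x /sub xs|x [_ _]];
    first by exists 0%N.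
  by move=> /lL; exact.
have [ubL|nub] := pselect (has_ubound L); last first.
  have Ln (x : R) : L x.
    apply: contrapT => nLx; apply: nub; exists x => y Ly.
    by rewrite leNgt; apply/negP => /ltW xy; apply: nLx; exact: lL Ly.
  exists (fun n => n%:R); split=> // [m n mn|]; first by rewrite ler_nat.
  apply/seteqP; split=> x //= _; exists (Num.truncn x).+1 => //=.
  by rewrite ltW// truncnS_gt.
have supL : has_sup L by split=> //; exists x0.
have below x : x < sup L -> L x.
  move=> /(sup_gt (ex_intro _ x0 Lx0)) [y Ly /ltW xy]; exact: lL Ly.
exists (fun n => sup L - n.+1%:R^-1); split=> [m n mn|n|].
- by rewrite lerD2l lerN2 lef_pV2 ?posrE// ler_nat.
- by apply: below; rewrite ltrBlDr ltrDl.
- apply/seteqP; split=> [x Lx|x [n _ /= xn]]; last first.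
    by apply: below; apply: (le_lt_trans xn); rewrite ltrBlDr ltrDl.
  have xs : x < sup L.
    rewrite lt_neqAle ub_le_sup// andbT; apply/eqP => xE.
    by apply: nomax; exists x => // y Ly; rewrite xE; exact: ub_le_sup.
  have /ltr_add_invr [n] := xs; rewrite -ltrBrDr => /ltW xn.
  by exists n.
Qed.

(** Continuity from below along the half-lines that exhaust [L]. *)
Lemma lower_set_approx (nu : probability R R) (L : set R) c :
  lower_set L -> L !=set0 -> (c < nu L)%E ->
  exists2 a, L a & (c < nu (Iic a))%E.
Proof.
move=> lL L0; have [a [nda La EL]] := lower_set_bigcup lL L0; rewrite {1}EL => cL.
have ma n : measurable (Iic (a n)) by rewrite -set_itvNyc.
have cv : nu (Iic (a n)) @[n --> \oo] --> nu (\bigcup_n (Iic (a n))).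
  apply: nondecreasing_cvg_mu => //; first exact: bigcup_measurable.
  by move=> m n mn; apply/subsetPset => x /= /le_trans; apply; exact: nda.
have [n _ /(_ n (leqnn n)) cn] := cv _ (open_ereal_gt' cL).
by exists (a n).
Qed.

(** Otherwise a closed half-line inside [L] would have [nu]-mass above the [mu]-mass of [L]. This
    extends the stochastic order to the sets [{phi <= t}], which need not be closed half-lines. *)
Lemma lower_set_le (nu mu : probability R R) (L : set R) : lower_set L ->
  (forall t, (nu (Iic t) <= mu (Iic t))%E) -> (nu L <= mu L)%E.
Proof.
move=> lL numu; rewrite leNgt; apply/negP => muL.
have L0 : L !=set0 by apply/set0P/eqP => L0; rewrite L0 !measure0 ltxx in muL.
have [a La] := lower_set_approx lL L0 muL; apply/negP; rewrite -leNgt.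
apply: (le_trans (numu a)); apply: le_measure; rewrite ?inE.
- by rewrite -set_itvNyc.
- exact: measurable_lower_set.
- by move=> x /= xa; exact: lL La.
Qed.

(** Continuity from above along the half-lines ending at [t + 1/(n+1)]. *)
Lemma cdf_right_limit (mu : probability R R) t x :
  (forall s, t < s -> (x <= mu (Iic s))%E) -> (x <= mu (Iic t))%E.
Proof.
move=> H.
pose F n := [set y : R | y <= t + n.+1%:R^-1].
have mF n : measurable (F n) by rewrite /F -set_itvNyc.
have -> : (Iic t) = \bigcap_n F n.
  apply/seteqP; split=> [y /= yt n _|y /= h].
    by rewrite /F/= (le_trans yt)// lerDl.
  apply/ler_addgt0Pr => e e0.
  have [n] := ltr_add_invr e0; rewrite add0r => ne.
  by apply: (le_trans (h n I)); rewrite lerD2l ltW.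
have cv : mu \o F @ \oo --> mu (\bigcap_n F n).
  apply: nonincreasing_cvg_mu => //.
  - by rewrite -ge0_fin_numE// fin_num_measure.
  - exact: bigcapT_measurable.
  - move=> m n mn; apply/subsetPset => y /= /le_trans; apply.
    by rewrite lerD2l lef_pV2 ?posrE// ler_nat.
rewrite -(cvg_lim _ cv)//; apply: lime_ge; first by apply/cvg_ex; eexists;
  exact: cv.
by apply: nearW => n; apply: H; rewrite ltrDl.
Qed.

End law_of_sums.

(** * Convex transformations, sums and maxima *)

Lemma measurable_wsum (R : realType) n (theta : 'I_n -> R)
    d' (T' : measurableType d') (P' : probability T' R) (X' : 'I_n -> {RV P' >-> R}) :
  measurable_fun setT (fun w => \sum_(i < n) theta i * X' i w).
Proof. by apply: measurable_sum => i; exact: measurable_funM. Qed.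

Lemma measurable_Iic (R : realType) d' (T' : measurableType d') (f : T' -> R)
    (t : R) :
  measurable_fun setT f -> measurable [set w | f w <= t].
Proof.
move=> mf; rewrite -[X in measurable X]setTI.
by apply: (mf measurableT (Iic t)); rewrite -set_itvNyc.
Qed.

Section convex_transformations.
Context (R : realType) (phi : R -> R).
Hypothesis phi_nd : forall x y : R, x <= y -> phi x <= phi y.
Hypothesis phi_convex : forall x y l : R, 0 <= l -> l <= 1 ->
  phi (l * x + (1 - l) * y) <= l * phi x + (1 - l) * phi y.

(** The weights are not normalized, so the induction hypothesis applies directly once the last one
    is dropped. *)
Lemma weighted_jensen n (theta x : 'I_n -> R) : (forall i, 0 <= theta i) ->
  0 < \sum_(i < n) theta i ->
  phi ((\sum_(i < n) theta i * x i) / \sum_(i < n) theta i) <=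
  (\sum_(i < n) theta i * phi (x i)) / \sum_(i < n) theta i.
Proof.
elim: n theta x => [|n IH] theta x th0; first by rewrite big_ord0 ltxx.
rewrite !big_ord_recr/=.
set s := \sum_(i < n) theta _; set t := theta ord_max; set y := x ord_max.
have t0 : 0 <= t by exact: th0.
have : 0 <= s by apply: sumr_ge0.
rewrite le_eqVlt => /predU1P[s0|s0 st0].
  (* Here the earlier weights sum to zero, hence all vanish, and only the last point is left. *)
  have th00 i : theta (widen_ord (leqnSn n) i) = 0.
    by apply/eqP; move: (esym s0) => /eqP; rewrite psumr_eq0// => /allP/(_ i);
      apply; rewrite mem_index_enum.
  rewrite -s0 !big1 ?add0r => [tp|i _|i _]; rewrite ?th00 ?mul0r//.
  by rewrite [t * y / t]mulrAC [t * phi y / t]mulrAC divff ?mul1r// gt_eqF.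
have := IH (fun i => theta (widen_ord (leqnSn n) i))
  (fun i => x (widen_ord (leqnSn n) i)) (fun i => th0 _) s0.
rewrite -/s; set a := \sum_(i < n) _; set b := \sum_(i < n) _ => ab.
have l0 : 0 <= s / (s + t) by rewrite divr_ge0// ltW.
have l1 : s / (s + t) <= 1 by rewrite ler_pdivrMr// mul1r lerDl.
(* The full mean is a convex combination of the mean [a / s] of the first [n] points and the last
   point [y]. *)
have -> : (a + t * y) / (s + t) = s / (s + t) * (a / s) + (1 - s / (s + t)) * y.
  by field; rewrite !gt_eqF.
apply: (le_trans (phi_convex _ _ l0 l1)).
have -> : (b + t * phi y) / (s + t) =
    s / (s + t) * (b / s) + (1 - s / (s + t)) * phi y.
  by field; rewrite !gt_eqF.
by rewrite lerD2r ler_wpM2l.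
Qed.

Lemma Dminus_convex d (T : measurableType d) (P : probability T R)
    (X Z : {RV P >-> R}) :
  Dminus (distribution P X) -> (forall w, Z w = phi (X w)) ->
  Dminus (distribution P Z).
Proof.
move=> DX ZX; apply: Dminus_intro => n theta th0 th1.
have [d' [T' [P' [X' [indX lawX]]]]] := iid_exists (distribution P X) n.+1.
have mphi : measurable_fun setT phi by exact: nondecreasing_measurable.
have mphiV (A : set R) : measurable A -> measurable (phi @^-1` A).
  by move=> mA; rewrite -[X in measurable X]setTI; exact: mphi.
have mY i : measurable_fun setT (phi \o X' i) by exact: measurableT_comp.
exists d', T', P', (fun i => mfun_of (mY i)); split.
  split=> [B mB|i A mA].
    exact: (indX (fun i => phi @^-1` B i) (fun i => mphiV _ (mB i))).
  rewrite [LHS](lawX i (phi @^-1` A) (mphiV _ mA)).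
  by congr (P _); apply/seteqP; split=> w; rewrite /= ZX.
move=> t; pose L := phi @^-1` Iic t.
have lL : lower_set L by move=> x y xy /= ; apply: le_trans; exact: phi_nd.
have mL := measurable_lower_set lL.
pose S w := \sum_(i < n.+1) theta i * X' i w.
have mS : measurable_fun setT S.
  exact: measurable_wsum.
have : (distribution P' (mfun_of mS) L <= distribution P' (X' ord0) L)%E.
  by apply: lower_set_le => // s; exact: DX.
apply: le_trans; apply: le_measure; rewrite ?inE.
- apply: measurable_Iic; apply: measurable_sum => i.
  by apply: measurable_funM => //; exact: mY.
- exact: measurable_funPTI.
(* By Jensen, [phi (S w)] is at most the weighted sum of the [phi (X' i w)], so if that sum is at
   most [t] then [S w] lies in [L]. *)
- move=> w /= ; rewrite /L/=; apply: le_trans.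
  have := weighted_jensen (fun i => X' i w) th0.
  by rewrite th1 !divr1; apply.
Qed.

End convex_transformations.

(** * Families on the two factors of a product space *)

Section independent_pairs.
Context (R : realType) (mu nu : probability R R) n
  d1 (T1 : measurableType d1) (P1 : probability T1 R) (X : 'I_n -> {RV P1 >-> R})
  d2 (T2 : measurableType d2) (P2 : probability T2 R) (Y : 'I_n -> {RV P2 >-> R}).
Hypotheses (iidX : iid_with X mu) (iidY : iid_with Y nu).

Lemma measurable_pair (i : 'I_n) :
  measurable_fun setT (fun w : T1 * T2 => (X i w.1, Y i w.2)).
Proof.
by apply: measurable_fun_pair; apply: measurableT_comp.
Qed.

Let V i := mfun_of (measurable_pair i).

Lemma pair_preimageX i A B :
  V i @^-1` (A `*` B) = (X i @^-1` A) `*` (Y i @^-1` B).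
Proof. by []. Qed.

Lemma pair_indep (C : 'I_n -> set (R * R)) : (forall i, measurable (C i)) ->
  prodP P1 P2 (\bigcap_(i in [set: 'I_n]) (V i @^-1` C i)) =
  (\prod_(i < n) prodP mu nu (C i))%E.
Proof.
(* Replace rectangles by arbitrary sets one coordinate at a time. *)
suff H m : (m <= n)%N -> forall C : 'I_n -> set (R * R),
    (forall i, measurable (C i)) ->
    (forall i : 'I_n, (m <= i)%N -> exists A B, [/\ measurable A,
      measurable B & C i = A `*` B]) ->
    prodP P1 P2 (\bigcap_(i in [set: 'I_n]) (V i @^-1` C i)) =
    (\prod_(i < n) prodP mu nu (C i))%E.
  by move=> mC; apply: (H n) => // i; rewrite leqNgt ltn_ord.
have [[indX lawX] [indY lawY]] := (iidX, iidY).
elim: m => [_|m IH mn] {}C mC rC.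
  have /choice[A /choice[B AB]] := fun i => rC i (leq0n i).
  have -> : \bigcap_(i in [set: 'I_n]) (V i @^-1` C i) =
      (\bigcap_(i in [set: 'I_n]) (X i @^-1` A i)) `*`
      (\bigcap_(i in [set: 'I_n]) (Y i @^-1` B i)).
    apply/seteqP; split=> [[x y] h|[x y] [h1 h2] i _].
      by split=> i _; have := h i I; have [_ _ ->] := AB i => -[].
    by have [_ _ ->] := AB i; split; [exact: h1|exact: h2].
  have mA i : measurable (A i) by have [] := AB i.
  have mB i : measurable (B i) by have [] := AB i.
  rewrite prodPE; last 2 first.
  - by apply: fin_bigcap_measurable => // i _; exact: measurable_funPTI.
  - by apply: fin_bigcap_measurable => // i _; exact: measurable_funPTI.
  rewrite indX// indY// -big_split/=; apply: eq_bigr => i _.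
  by have [_ _ ->] := AB i; rewrite prodPE// lawX// lawY.
pose k := Ordinal mn.
pose C' D i := if i == k then D else C i.
pose E := \bigcap_(i in [set: 'I_n]) (V i @^-1` C' setT i).
have EC D : \bigcap_(i in [set: 'I_n]) (V i @^-1` C' D i) = V k @^-1` D `&` E.
  apply/seteqP; split=> [w h|w [h1 h2] i _].
    split; first by have := h k I; rewrite /C' eqxx.
    by move=> i _; have := h i I; rewrite /C'; case: eqP.
  by have := h2 i I; rewrite /C'; case: eqP => [->|].
have mC' D i : measurable D -> measurable (C' D i).
  by move=> mD; rewrite /C'; case: eqP.
have mE : measurable E.
  by apply: fin_bigcap_measurable => // i _; apply: measurable_funPTI; exact: mC'.
(* With a rectangle at [k], all indices from [m] on carry rectangles and the induction hypothesis
   applies; [product_law] then passes from rectangles to the set [C k]. *)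
have rect A B : measurable A -> measurable B ->
    prodP P1 P2 (V k @^-1` (A `*` B) `&` E) =
    (mu A * nu B * \prod_(i < n | i != k) prodP mu nu (C i))%E.
  move=> mA mB; rewrite -EC IH//; last 3 first.
  - exact: ltnW.
  - by move=> i; apply: mC'; exact: measurableX.
  - move=> i mi; rewrite /C'; case: eqP => [_|/eqP ik]; first by exists A, B.
    by apply: rC; rewrite ltn_neqAle mi andbT eq_sym; exact: ik.
  rewrite (bigD1 k)//= /C' eqxx prodPE//; congr (_ * _)%E.
  by apply: eq_bigr => i /negbTE ->.
have PE : prodP P1 P2 E = (\prod_(i < n | i != k) prodP mu nu (C i))%E.
  by rewrite -[E]setTI -(preimage_setT (V k)) -setXTT rect// !probability_setT
    !mul1e.
have -> : C = C' (C k) by apply/funext => i; rewrite /C'; case: eqP => [->|].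
rewrite EC (@product_law _ _ _ _ _ _ _ (prodP P1 P2) (V k) E mu nu)//; last first.
  by move=> A B mA mB; rewrite rect// PE.
rewrite PE [in RHS](bigD1 k)//= /C' eqxx; congr (_ * _)%E.
by apply: eq_bigr => i /negbTE ->.
Qed.

Lemma pair_law i (C : set (R * R)) : measurable C ->
  prodP P1 P2 (V i @^-1` C) = prodP mu nu C.
Proof.
have [[_ lawX] [_ lawY]] := (iidX, iidY).
move=> mC; rewrite -[V i @^-1` C]setIT (@product_law _ _ _ _ _ _ _ _ _ _ mu nu)//.
  by rewrite probability_setT mule1.
move=> A B mA mB; rewrite setIT pair_preimageX !probability_setT mule1 prodPE;
  try exact: measurable_funPTI.
  by rewrite lawX// lawY.
Qed.

End independent_pairs.

Section functions_of_pairs.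
Context (R : realType) (h : R * R -> R) (mh : measurable_fun setT h).
Context d (T : measurableType d) (P : probability T R) (X Y Z : {RV P >-> R}).

(** On the product space the pairs of [X' i] and [Y' i] are i.i.d. with the joint law of [X] and
    [Y], which is a product by independence. Hence their images under [h] form a test family for the
    law of [Z]. *)
Lemma Dminus_pair : independent2 X Y -> (forall w, Z w = h (X w, Y w)) ->
  (forall n (theta : 'I_n.+1 -> R), (forall i, 0 <= theta i) ->
    \sum_(i < n.+1) theta i = 1 ->
    forall d1 (T1 : measurableType d1) (P1 : probability T1 R)
      (X' : 'I_n.+1 -> {RV P1 >-> R})
      d2 (T2 : measurableType d2) (P2 : probability T2 R)
      (Y' : 'I_n.+1 -> {RV P2 >-> R}),
    iid_with X' (distribution P X) -> iid_with Y' (distribution P Y) ->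
    forall t : R,
      (prodP P1 P2 [set w | (\sum_(i < n.+1)
         theta i * h (X' i w.1, Y' i w.2) <= t)%R] <=
       prodP P1 P2 [set w | (h (X' ord0 w.1, Y' ord0 w.2) <= t)%R])%E) ->
  Dminus (distribution P Z).
Proof.
move=> indXY ZE H; apply: Dminus_intro => n theta th0 th1.
have [d1 [T1 [P1 [X' iidX]]]] := iid_exists (distribution P X) n.+1.
have [d2 [T2 [P2 [Y' iidY]]]] := iid_exists (distribution P Y) n.+1.
have mhV i := measurableT_comp mh (measurable_pair X' Y' i).
have mhC (A : set R) : measurable A -> measurable (h @^-1` A).
  by move=> mA; rewrite -[X in measurable X]setTI; exact: mh.
exists _, (T1 * T2)%type, (prodP P1 P2), (fun i => mfun_of (mhV i)); split;
  last first.
  by move=> t; exact: H.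
have lawZ i (A : set R) : measurable A ->
    prodP P1 P2 (mfun_of (mhV i) @^-1` A) =
      prodP (distribution P X) (distribution P Y) (h @^-1` A).
  by move=> mA; rewrite -(pair_law iidX iidY i (mhC _ mA)).
split=> [B mB|i A mA].
  under eq_bigr do rewrite lawZ//.
  by rewrite -(pair_indep iidX iidY)// => i; exact: mhC.
rewrite lawZ//.
pose W := mfun_of (measurable_fun_pair (@measurable_funPT _ _ _ _ X)
  (@measurable_funPT _ _ _ _ Y)).
rewrite -[RHS]/(P (Z @^-1` A)) (_ : Z @^-1` A = W @^-1` (h @^-1` A) `&` setT);
  last first.
  by rewrite setIT; apply/seteqP; split=> w; rewrite /= ZE.
rewrite (@product_law _ _ _ _ _ _ _ P W setT
  (distribution P X) (distribution P Y))//.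
- by rewrite probability_setT mule1.
- by move=> A' B' mA' mB'; rewrite setIT probability_setT mule1; exact: indXY.
- exact: mhC.
Qed.

End functions_of_pairs.

Section sum_and_max.
Context (R : realType) d (T : measurableType d) (P : probability T R)
  (X Y Z : {RV P >-> R}).
Hypotheses (DX : Dminus (distribution P X)) (DY : Dminus (distribution P Y))
  (indXY : independent2 X Y).

(** A maximum is at most [t] exactly on a rectangle, so the two hypotheses are multiplied factor by
    factor. *)
Lemma Dminus_max : (forall w, Z w = Num.max (X w) (Y w)) ->
  Dminus (distribution P Z).
Proof.
move=> ZE; apply: (Dminus_pair (h := fun p : R * R => Num.max p.1 p.2) _ indXY ZE).
  by apply: measurable_maxr; [exact: measurable_fst|exact: measurable_snd].
move=> n theta th0 th1 d1 T1 P1 X' d2 T2 P2 Y' iidX iidY t /=.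
have -> : [set w : T1 * T2 | (Num.max (X' ord0 w.1) (Y' ord0 w.2) <= t)%R] =
    [set x | (X' ord0 x <= t)%R] `*` [set y | (Y' ord0 y <= t)%R].
  by apply/seteqP; split=> w /=; rewrite ge_max => /andP.
rewrite [leRHS]prodPE; try exact: measurable_Iic.
apply: (@le_trans _ _ (prodP P1 P2
    ([set x | (\sum_(i < n.+1) theta i * X' i x <= t)%R] `*`
     [set y | (\sum_(i < n.+1) theta i * Y' i y <= t)%R]))); last first.
  rewrite prodPE; try by apply: measurable_Iic; exact: measurable_wsum.
  by apply: lee_pmul => //; [exact: DX|exact: DY].
apply: le_measure; rewrite ?inE.
- apply: measurable_Iic; apply: measurable_sum => i; apply: measurable_funM => //.
  by apply: measurable_maxr; apply: measurableT_comp.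
- by apply: measurableX; apply: measurable_Iic; exact: measurable_wsum.
- move=> [x y] /= h; split; apply: le_trans h; apply: ler_sum => i _;
  by rewrite ler_wpM2l// le_max lexx ?orbT.
Qed.

Lemma Dminus_add : (forall w, Z w = X w + Y w) -> Dminus (distribution P Z).
Proof.
move=> ZE; apply: (Dminus_pair (h := fun p : R * R => p.1 + p.2) _ indXY ZE).
  by apply: measurable_funD; [exact: measurable_fst|exact: measurable_snd].
move=> n theta th0 th1 d1 T1 P1 X' d2 T2 P2 Y' iidX iidY t /=.
pose SX x := \sum_(i < n.+1) theta i * X' i x.
pose SY y := \sum_(i < n.+1) theta i * Y' i y.
have mSX : measurable_fun setT SX by exact: measurable_wsum.
have mSY : measurable_fun setT SY by exact: measurable_wsum.
have mtC (f : T1 -> R) (g : T2 -> R) :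
    measurable_fun setT f -> measurable_fun setT g ->
    measurable [set w | f w.1 + g w.2 <= t].
  move=> mf mg; apply: measurable_Iic; apply: measurable_funD;
    apply: measurableT_comp => //.
have SE w : \sum_(i < n.+1) theta i * (X' i w.1 + Y' i w.2) = SX w.1 + SY w.2.
  by rewrite /SX /SY -big_split; apply: eq_bigr => i _; rewrite mulrDr.
under eq_set do rewrite SE.
(* First replace [SX] by [X' ord0] with [y] frozen, then [SY] by [Y' ord0] with [x] frozen. *)
apply: (@le_trans _ _ (prodP P1 P2 [set w | (X' ord0 w.1 + SY w.2 <= t)%R])).
  apply: prodP_le_ysection => [||y]; try exact: mtC.
  have sec (f : T1 -> R) :
      ysection [set w | f w.1 + SY w.2 <= t] y = [set x | f x <= t - SY y].
    by rewrite ysectionE; apply/seteqP; split=> x /=; rewrite lerBrDr.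
  by rewrite !sec; exact: DX.
apply: prodP_le_xsection => [||x]; try exact: mtC.
have sec (g : T2 -> R) :
    xsection [set w | X' ord0 w.1 + g w.2 <= t] x = [set y | g y <= t - X' ord0 x].
  by rewrite xsectionE; apply/seteqP; split=> y /=; rewrite lerBrDl.
by rewrite !sec; exact: DY.
Qed.

End sum_and_max.

(** * Weak limits *)

Section stochastic_liminf.
Context (R : realType).

Lemma limn_einf_gt (u : nat -> \bar R) c : (c < limn_einf u)%E ->
  \forall k \near \oo, (c < u k)%E.
Proof.
rewrite limn_einf_lim (cvg_lim _ (@cvg_einfs_sup _ _))// =>
  /ereal_sup_gt[_ [n _ <-] cn].
exists n => // k /= nk; apply: (lt_le_trans cn).
by apply: ereal_inf_lbound; exists k.
Qed.

Lemma le_limn_einf (u : nat -> \bar R) x : x \is a fin_num ->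
  (forall c, (c < x)%E -> \forall k \near \oo, (c < u k)%E) -> (x <= limn_einf u)%E.
Proof.
move=> xfin H; rewrite limn_einf_lim (cvg_lim _ (@cvg_einfs_sup _ _))//.
rewrite -(fineK xfin); apply/lee_addgt0Pr => e e0.
have [|n _ cn] := H (fine x - e)%:E.
  by rewrite -[ltRHS](fineK xfin) lte_fin ltrBlDr ltrDl.
rewrite -leeBlDr//; apply: (@le_trans _ _ (einfs u n)); last first.
  by apply: ereal_sup_ubound; exists n.
by apply: le_ereal_inf_tmp => _ [k /= nk <-]; exact/ltW/cn.
Qed.

(** The lower half of the portmanteau theorem, on open half-lines: a one-sided condition of the kind
    that Fatou's lemma propagates. *)
Definition st_liminf (nu_ : nat -> probability R R) (nu : probability R R) :=
  forall t : R, (nu (Iio t) <= limn_einf (fun k => nu_ k (Iio t)))%E.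

(** For a lower set, openness means having no greatest element; this form covers the empty set and
    the whole line too. *)
Definition open_lower_set (L : set R) :=
  lower_set L /\ forall x, L x -> exists2 y, x < y & L y.

Lemma open_lower_set_approx (nu : probability R R) L c : open_lower_set L ->
  L !=set0 -> (c < nu L)%E -> exists2 y, L y & (c < nu (Iio y))%E.
Proof.
move=> [lL oL] L0 cL; have [a La ca] := lower_set_approx lL L0 cL.
have [y ay Ly] := oL a La; exists y => //; apply: (lt_le_trans ca).
apply: le_measure; rewrite ?inE; first by rewrite -set_itvNyc.
- by rewrite -set_itvNyo.
- by move=> x /= /le_lt_trans; exact.
Qed.

Lemma st_liminf_open (nu_ : nat -> probability R R) nu L c :
  st_liminf nu_ nu -> open_lower_set L -> (0 <= c)%E -> (c < nu L)%E ->
  \forall k \near \oo, (c < nu_ k L)%E.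
Proof.
move=> nunu oL c0 cL.
have L0 : L !=set0.
  by apply/set0P/eqP => L0; move: cL; rewrite L0 measure0 ltNge c0.
have [y Ly cy] := open_lower_set_approx oL L0 cL.
have : \forall k \near \oo, (c < nu_ k (Iio y))%E.
  exact/limn_einf_gt/(lt_le_trans cy).
apply: filterS => k /lt_le_trans; apply; apply: le_measure; rewrite ?inE.
- by rewrite -set_itvNyo.
- by apply: measurable_lower_set; have [] := oL.
- by move=> x /= /ltW xy; have [lL _] := oL; exact: lL Ly.
Qed.

Section shift.
Variables (c t : R).
Hypothesis c0 : 0 <= c.

Lemma open_lower_set_section s : open_lower_set [set x | s + c * x < t].
Proof.
split=> [x y xy /=|x /= xt]; first by apply: le_lt_trans; rewrite lerD2l ler_wpM2l.
(* Moving by the slack over [2 * (c + 1)] uses up less than the slack after multiplication by [c],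
   and the denominator is positive even when [c] is zero. *)
exists (x + (t - (s + c * x)) / (2 * (c + 1))).
  by rewrite ltrDl divr_gt0// ?subr_gt0// mulr_gt0// ltr_wpDl.
set e := t - _; have e0 : 0 < e by rewrite subr_gt0.
rewrite mulrDr addrA -ltrBrDl -/e mulrCA.
have c1 : 0 < c + 1 by rewrite ltr_wpDl.
rewrite -[ltRHS]mulr1 ltr_pM2l// ltr_pdivrMr; last by rewrite mulr_gt0.
rewrite mul1r; lra.
Qed.

Let section_law (mu : probability R R) (s : R) : R :=
  fine (mu [set x | s + c * x < t]).

Let measurable_section s : measurable [set x | s + c * x < t].
Proof. by apply: measurable_lower_set; have [] := open_lower_set_section s. Qed.

Let section_law_ni mu s s' : s <= s' -> section_law mu s' <= section_law mu s.
Proof.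
move=> ss'; rewrite /section_law fine_le ?fin_num_measure//.
apply: le_measure; rewrite ?inE// => x /=; apply: le_lt_trans.
by rewrite lerD2r.
Qed.

Let measurable_section_law mu : measurable_fun setT (section_law mu).
Proof.
rewrite (_ : section_law mu = -%R \o (-%R \o section_law mu)); last first.
  by apply/funext => s /=; rewrite opprK.
apply: measurableT_comp => //; apply: nondecreasing_measurable => // s s' ss'.
by rewrite /= lerN2 section_law_ni.
Qed.

(** By Fubini the left side is the [nu]-expectation of [section_law mu], and the expectation of a
    nonnegative variable is the integral of its tail [ccdf]. *)
Lemma shift_law_layer_cake (nu mu : probability R R) :
  distribution (prodP nu mu) (mfun_of (measurable_shift c)) (Iio t) =
  (\int[lebesgue_measure]_(r in `[0%R, +oo[)
     @ccdf _ _ _ nu (mfun_of (measurable_section_law mu)) r)%E.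
Proof.
rewrite -ge0_expectation_ccdf; last by move=> s; exact: fine_ge0.
rewrite expectation_def; apply: eq_integral => s _.
rewrite /= /section_law fineK ?fin_num_measure//.
by rewrite xsectionE.
Qed.

(** Fatou's lemma reduces the claim to a fixed level [r] of the layer-cake integral. There the
    superlevel set [L] of the section mass is an open lower set, compared with its analogues for
    [mu_ k]. *)
Lemma st_liminf_shift (nu_ mu_ : nat -> probability R R) nu mu :
  st_liminf nu_ nu -> st_liminf mu_ mu ->
  (distribution (prodP nu mu) (mfun_of (measurable_shift c)) (Iio t) <=
   limn_einf (fun k =>
     distribution (prodP (nu_ k) (mu_ k)) (mfun_of (measurable_shift c))
       (Iio t)))%E.
Proof.
move=> nunu mumu.
rewrite shift_law_layer_cake.
under [in leRHS]eq_fun do rewrite shift_law_layer_cake.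
pose f k r := @ccdf _ _ _ (nu_ k) (mfun_of (measurable_section_law (mu_ k))) r.
have mf k : measurable_fun (`[0%R, +oo[%classic : set R) (f k).
  exact: measurable_funTS (@ccdf_measurable _ _ _ _ _).
apply: (@le_trans _ _ (\int[lebesgue_measure]_(r in `[0%R, +oo[)
  limn_einf (f^~ r))%E); last by apply: fatou.
apply: ge0_le_integral => //.
- exact: measurable_funTS (@ccdf_measurable _ _ _ _ _).
- apply: measurableT_comp => //; apply: measurable_fun_limn_esup => k.
  by apply: measurableT_comp => //; exact: mf.
move=> r; rewrite /= in_itv/= andbT => r0.
have ccdfE nu' mu' : @ccdf _ _ _ nu' (mfun_of (measurable_section_law mu')) r =
    nu' [set s | (r%:E < mu' [set x | (s + c * x < t)%R])%E].
  rewrite /ccdf /distribution /pushforward; congr (nu' _).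
  apply/seteqP; split=> s; rewrite /= in_itv/= andbT /section_law -lte_fin;
    by rewrite fineK// fin_num_measure.
rewrite ccdfE; under [in leRHS]eq_fun do rewrite /f ccdfE.
set L := [set s | _].
have lL (mu' : probability R R) :
  lower_set [set s | (r%:E < mu' [set x | (s + c * x < t)%R])%E].
  move=> s s' ss' /=; move/lt_le_trans; apply; apply: le_measure; rewrite ?inE//.
  by move=> x /=; apply: le_lt_trans; rewrite lerD2r.
have oL : open_lower_set L.
  split=> [|s Ls]; first exact: lL.
  have A0 : [set x | s + c * x < t] !=set0.
    apply/set0P/eqP => A0; move: Ls; rewrite /L/= A0 measure0 lte_fin => r0'.
    by move: r0; rewrite leNgt r0'.
  have [y yA ry] := open_lower_set_approx (open_lower_set_section s) A0 Ls.
  (* Since [s + c * y < t], the midpoint of [s] and [t - c * y] exceeds [s], and its section still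
     contains [Iio y]. *)
  exists ((s + (t - c * y)) / 2); first by move: yA => /=; lra.
  rewrite /L/=; apply: (lt_le_trans ry); apply: le_measure; rewrite ?inE//.
    by rewrite -set_itvNyo.
  move=> x /= /ltW xy; apply: (@le_lt_trans _ _ ((s + (t - c * y)) / 2 + c * y)).
    by rewrite lerD2l ler_wpM2l.
  by move: yA => /=; lra.
apply: le_limn_einf.
  by apply: fin_num_measure; exact: measurable_lower_set (proj1 oL).
move=> a aL.
have [L0|/set0P/negP/negPn/eqP L0] := pselect (L !=set0); last first.
  apply: nearW => k; apply: (@lt_le_trans _ _ 0%E) => //.
  by move: aL; rewrite L0 measure0.
have [y Ly ay] := open_lower_set_approx oL L0 aL.
have nuy := limn_einf_gt (lt_le_trans ay (nunu y)).
(* Eventually the section at [y] has [mu_ k]-mass above [r]. Section masses decrease in the first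
   summand, so all of [Iio y] then lies in the superlevel set for [mu_ k]. *)
have muy := st_liminf_open mumu (open_lower_set_section y) (r0 : (0 <= r%:E)%E) Ly.
near=> k; apply: (@lt_le_trans _ _ (nu_ k (Iio y))); first by near: k.
apply: le_measure; rewrite ?inE; first by rewrite -set_itvNyo.
  exact: measurable_lower_set (lL (mu_ k)).
move=> s /= /ltW sy; apply: (lL (mu_ k) s y sy) => /=; near: k; exact: muy.
Unshelve. all: by end_near. Qed.

End shift.

Lemma st_liminf_wsum (mu_ : nat -> probability R R) mu theta m :
  (forall i, 0 <= theta i) -> st_liminf mu_ mu ->
  st_liminf (fun k => wsum (mu_ k) theta m) (wsum mu theta m).
Proof.
move=> th0 mumu; elim: m => [|m IH] t; last exact: st_liminf_shift.
apply: le_limn_einf; first by rewrite fin_num_measure// -set_itvNyo.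
by move=> a at0; apply: nearW.
Qed.

End stochastic_liminf.

(** * Continuity points and passage to the weak limit *)

Section weak_limit.
Context (R : realType).

Lemma distfunE (mu : probability R R) t : (distfun mu t)%:E = mu (Iic t).
Proof. by rewrite /distfun fineK// fin_num_measure// -set_itvNyc. Qed.

Lemma distfun_nondecreasing (mu : probability R R) s t : s <= t ->
  distfun mu s <= distfun mu t.
Proof.
move=> st; rewrite -lee_fin !distfunE; apply: le_measure;
  rewrite ?inE -?set_itvNyc//.
exact: subitvPr.
Qed.

(** Without an atom at [s], [Iio s] and [Iic s] have equal mass, and inner approximation of [Iio s]
    gives left continuity; right continuity always holds. *)
Lemma continuous_distfun (mu : probability R R) s : mu [set s] = 0%E ->
  {for s, continuous (distfun mu)}.
Proof.
move=> mus; apply/cvgrPdist_lt => e e0.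
have [a /= sa Fa] : exists2 a, Iio s a & distfun mu s - e < distfun mu a.
  have lIio : lower_set (Iio s) by move=> x y /le_lt_trans; exact.
  have [||a sa Fa] := @lower_set_approx _ mu (Iio s) (distfun mu s - e)%:E lIio.
  - by exists (s - 1); rewrite /= ltrBlDr ltrDl.
  - have -> : mu (Iio s) = mu (Iic s).
      have -> : Iic s = Iio s `|` [set s].
        apply/seteqP; split=> [x /=|x [/= /ltW//|->//=]].
        by rewrite le_eqVlt => /predU1P[->|]; [right|left].
      rewrite measureU//; first by rewrite [X in (_ + X)%E]mus adde0.
      - by rewrite -set_itvNyo.
      - by apply/seteqP; split=> x //= [] + xs; rewrite xs ltxx.
    by rewrite -distfunE lte_fin ltrBlDr ltrDl.
  by exists a => //; rewrite -lte_fin distfunE.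
have [b sb Fb] : exists2 b, s < b & distfun mu b < distfun mu s + e.
  apply: contrapT => /forall2NP H.
  have : (((distfun mu s + e)%:E <= mu (Iic s)))%E.
    apply: cdf_right_limit => y sy; rewrite -distfunE lee_fin leNgt; apply/negP.
    by have [] := H y.
  by rewrite -distfunE lee_fin leNgt ltrDl e0.
have : s \in `]a, b[ by rewrite in_itv/= sa.
move=> /near_in_itvoo; apply: filterS => x; rewrite in_itv/= =>
  /andP[/ltW ax /ltW xb].
have := distfun_nondecreasing mu ax; have := distfun_nondecreasing mu xb.
by rewrite ltr_norml; lra.
Qed.

(** Otherwise every point of the interval is an atom, but the atoms are countable and so
    Lebesgue-null. *)
Lemma exists_continuity_point (mu : probability R R) a b : a < b ->
  exists s, [/\ a < s, s < b & {for s, continuous (distfun mu)}].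
Proof.
move=> ab; apply: contrapT => H.
have cAB := @pmf_gt0_countable _ _ _ mu (mfun_of (@measurable_id _ _ _)).
have : (lebesgue_measure `]a, b[%classic <= @lebesgue_measure R
    [set r | (0 < @pmf _ _ _ mu (mfun_of (@measurable_id _ _ _)) r)%R])%E.
  apply: le_measure; rewrite ?inE//; first exact: countable_measurable.
  move=> s; rewrite /= in_itv/= => /andP[as_ sb].
  rewrite lt_neqAle pmf_ge0 andbT; apply/eqP => mus; apply: H; exists s; split=> //.
  apply: continuous_distfun; rewrite -[LHS]fineK ?fin_num_measure//.
  by rewrite [X in _ = X%:E]mus.
rewrite [leRHS]countable_lebesgue_measure0// lebesgue_measure_itv/= lte_fin ab.
by rewrite lee_fin leNgt subr_gt0 ab.
Qed.

(** Exhaust [Iio t] by some [Iic a] with [a < t], then use convergence at a continuity point between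
    [a] and [t]. *)
Lemma st_liminf_cvg (mu_ : nat -> probability R R) mu :
  cvg_in_distribution mu_ mu -> st_liminf mu_ mu.
Proof.
move=> mumu t; apply: le_limn_einf; first by rewrite fin_num_measure// -set_itvNyo.
move=> c ct.
have lIio : lower_set (Iio t) by move=> x y /le_lt_trans; exact.
have [|a /= at_ ca] := lower_set_approx lIio _ ct.
  by exists (t - 1); rewrite /= ltrBlDr ltrDl.
have [s [as_ st sC]] := exists_continuity_point mu at_.
have cs : (c < (distfun mu s)%:E)%E.
  rewrite distfunE; apply: (lt_le_trans ca).
  by rewrite -!distfunE lee_fin distfun_nondecreasing// ltW.
have cv : (distfun (mu_ k) s)%:E @[k --> \oo] --> (distfun mu s)%:E.
  by apply: cvg_EFin; [exact: nearW|exact: mumu].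
have : \forall k \near \oo, (c < (distfun (mu_ k) s)%:E)%E.
  exact: (cv _ (open_ereal_gt' cs)).
apply: filterS => k /= /lt_le_trans; apply.
rewrite distfunE; apply: le_measure; rewrite ?inE -?set_itvNyc -?set_itvNyo//.
by move=> x; rewrite /= !in_itv/= => /le_lt_trans; exact.
Qed.

(** For [r > t] choose a continuity point [s] between them. Writing [S] and [S_k] for the weighted
    sums under [mu] and [mu_ k], [P(S <= t) <= P(S < s) <= liminf P(S_k < s) <= lim F_k(s) = F(s) <=
    F(r)]; then let [r] decrease to [t]. *)
Lemma Dminus_weak_limit (mu_ : nat -> probability R R) (mu : probability R R) :
  (forall k, Dminus (mu_ k)) -> cvg_in_distribution mu_ mu -> Dminus mu.
Proof.
move=> Dmu mumu n theta th0 th1 d T P X iidX t.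
rewrite [leRHS](iidX.2 ord0 (Iic t)); last by rewrite -set_itvNyc.
rewrite (iid_sum_law theta iidX (A := Iic t)); last by rewrite -set_itvNyc.
apply: cdf_right_limit => r tr.
have [s [ts sr sC]] := exists_continuity_point mu tr.
apply: (@le_trans _ _ (mu (Iic s))); last first.
  by rewrite -!distfunE lee_fin distfun_nondecreasing// ltW.
apply: (@le_trans _ _ (wsum mu (theta \o inord) n.+1 (Iio s))).
  apply: le_measure; rewrite ?inE -?set_itvNyc -?set_itvNyo//.
  by move=> x; rewrite /= !in_itv/= => /le_lt_trans; exact.
have LS := st_liminf_wsum (theta := theta \o inord) n.+1 (fun i => th0 _)
  (st_liminf_cvg mumu).
apply/lee_addgt0Pr => e e0; rewrite -distfunE -EFinD leNgt; apply/negP => eS.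
have ek := limn_einf_gt (lt_le_trans eS (LS s)).
have Fk : \forall k \near \oo, distfun (mu_ k) s < distfun mu s + e.
  move/cvgrPdist_lt : (mumu s sC) => /(_ e e0); apply: filterS => k.
  by rewrite ltr_norml; lra.
have [k [ek' Fk']] := filter_ex (filterI ek Fk).
suff : (wsum (mu_ k) (theta \o inord) n.+1 (Iio s) <= (distfun (mu_ k) s)%:E)%E.
  by move=> /(lt_le_trans ek'); rewrite lte_fin => /lt_trans/(_ Fk'); rewrite ltxx.
rewrite distfunE; apply: (le_trans _ (wsum_Dminus s (Dmu k) th0 th1)).
apply: le_measure; rewrite ?inE -?set_itvNyc -?set_itvNyo//.
by move=> x; rewrite /= !in_itv/= => /ltW.
Qed.

End weak_limit.

(** * Infinite mean *)

Section infinite_mean.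
Context (R : realType) (mu : probability R R).

Lemma measurable_Ioi d (T : measurableType d) (f : T -> R) (t : R) :
  measurable_fun setT f -> measurable [set w | t < f w].
Proof.
move=> mf; rewrite -[X in measurable X]setTI.
by apply: (mf measurableT (Ioi t)); rewrite -set_itvoy.
Qed.

(** The atom is the supremum of the points with no mass strictly to their left: nothing lies below
    it, and nothing lies beyond any larger point. *)
Lemma degenerate_of_sides :
  (forall c : R, mu (Iio c) = 0%E \/ mu (Ioi c) = 0%E) ->
  exists c : R, mu [set c] = 1%E.
Proof.
move=> H.
have mIio (c : R) : measurable (Iio c) by rewrite -set_itvNyo.
have mIic (c : R) : measurable (Iic c) by rewrite -set_itvNyc.
have muIic c : mu (Ioi c) = 0%E -> mu (Iic c) = 1%E.
  move=> c0; have -> : Iic c = ~` Ioi c.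
    by apply/seteqP; split=> x /=; rewrite leNgt => /negP.
  by rewrite probability_setC ?c0 ?sube0// -set_itvoy.
pose A := [set c : R | mu (Iio c) = 0%E].
(* If [A] were empty, every [Iic c] would have full mass, although these sets shrink to the empty
   set. *)
have A0 : A !=set0.
  apply: contrapT => nA.
  have muI c : mu (Iic c) = 1%E.
    by apply: muIic; have [c0|//] := H c; case: nA; exists c.
  have mF n : measurable (Iic (- n%:R : R)) by [].
  have : mu \o (fun n => Iic (- n%:R : R)) @ \oo --> mu
    (\bigcap_n Iic (- n%:R : R)).
    apply: nonincreasing_cvg_mu => //; first by rewrite /= muI ltry.
      exact: bigcapT_measurable.
    by move=> m n mn; apply/subsetPset => x /= /le_trans; apply;
      rewrite lerN2 ler_nat.
  have -> : \bigcap_n Iic (- n%:R : R) = set0.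
    apply/seteqP; split=> // x /(_ (Num.truncn (- x)).+1 I) /=.
    by rewrite lerNr leNgt truncnS_gt.
  rewrite measure0 (_ : mu \o _ = cst 1%E); last by apply/funext => n /=;
    rewrite muI.
  by move=> /(cvg_lim _) -/(_ (@ereal_hausdorff R)); rewrite lim_cst// => /eqP;
    rewrite onee_eq0.
(* If [A] were unbounded, every [Iio c] would be null, although these sets exhaust the line. *)
have ubA : has_ubound A.
  apply: contrapT => nub.
  have muI c : mu (Iio c) = 0%E.
    apply: contrapT => c0; apply: nub; exists c => y Ay; rewrite leNgt;
      apply/negP => cy.
    apply: c0; apply/eqP; rewrite -measure_le0 -[leRHS]Ay; apply: le_measure;
      rewrite ?inE//.
    by move=> x /= /lt_trans; exact.
  have lT : lower_set [set: R] by [].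
  have [||a _] := @lower_set_approx R mu setT 0%E lT; first by exists 0.
    by rewrite probability_setT.
  apply/negP; rewrite -leNgt -(muI (a + 1)); apply: le_measure; rewrite ?inE//.
  by move=> x /= /le_lt_trans; apply; rewrite ltrDl.
pose s := sup A; exists s.
have mus0 : mu (Iio s) = 0%E.
  apply/eqP; rewrite eq_le measure_ge0 andbT leNgt; apply/negP => s0.
  have lIio : lower_set (Iio s) by move=> x y /le_lt_trans; exact.
  have [|a /= as_] := lower_set_approx lIio _ s0; first by exists (s - 1);
    rewrite /= ltrBlDr ltrDl.
  have [b Ab ab] := sup_gt A0 as_.
  apply/negP; rewrite -leNgt -[leRHS]Ab; apply: le_measure; rewrite ?inE//.
  by move=> x /= /le_lt_trans; exact.
have mus1 : (1 <= mu (Iic s))%E.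
  apply: cdf_right_limit => r sr; rewrite muIic//; have [Ar|//] := H r.
  by move: sr; rewrite ltNge => /negP[]; exact: ub_le_sup.
apply/eqP; rewrite eq_le probability_le1//= (le_trans mus1)//.
rewrite -[leRHS]add0e -{1}mus0 -measureU//; last first.
  by apply/seteqP; split=> x //= [] /[swap] ->; rewrite ltxx.
apply: le_measure; rewrite ?inE//; first exact: measurableU.
by move=> x /=; rewrite le_eqVlt => /predU1P[->|]; [right|left].
Qed.

Hypotheses (Dmu : Dminus mu) (mean_fin : (\int[mu]_x `|x|%:E < +oo)%E).

Lemma sides_null c : mu (Iio c) = 0%E \/ mu (Ioi c) = 0%E.
Proof.
have [d [T [P [X iidX]]]] := iid_exists mu 2.
pose X0 := X ord0; pose X1 := X ord_max.
pose g (x : R) := Num.max (x - c) 0.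
have g0 x : 0 <= g x by rewrite /g le_max lexx orbT.
have mg : measurable_fun setT g.
  by apply: measurable_maxr => //; apply: measurable_funB.
have mgX i : measurable_fun setT (g \o X i) by exact: measurableT_comp.
(* [V] is twice [g (X0 w)] and [W] twice [g] at the midpoint of [X0 w] and [X1 w]; doubling avoids
   fractions. *)
pose V w := g (X0 w) + g (X0 w).
pose W w := Num.max (X0 w + X1 w - 2 * c) 0.
(* Twice the Jensen gap of [g] at [(X0 w + X1 w) / 2]. *)
pose G w := g (X0 w) + g (X1 w) - W w.
have mV : measurable_fun setT V by exact: measurable_funD (mgX _) (mgX _).
have mW : measurable_fun setT W.
  apply: measurable_maxr => //; apply: measurable_funB => //.
  exact: measurable_funD.
have mG : measurable_fun setT G.
  by apply: measurable_funB => //; exact: measurable_funD (mgX _) (mgX _).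
have W0 w : 0 <= W w by rewrite /W le_max lexx orbT.
have G0 w : 0 <= G w.
  have gge x : x - c <= g x by rewrite /g le_max lexx.
  have := gge (X0 w); have := gge (X1 w); have := g0 (X0 w); have := g0 (X1 w).
  by rewrite /G subr_ge0 /W ge_max => *; apply/andP; split; lra.
pose e := (\int[mu]_x (g x)%:E)%E.
have eE i : (\int[P]_w (g (X i w))%:E)%E = e.
  have <- : (\int[distribution P (X i)]_x (g x)%:E)%E =
    (\int[P]_w (g (X i w))%:E)%E.
    by rewrite ge0_integral_distribution//; exact/measurable_EFinP.
  by apply: eq_measure_integral => A mA _; exact: iidX.2.
have efin : e \is a fin_num.
  rewrite ge0_fin_numE; last by apply: integral_ge0 => x _; rewrite lee_fin.
  have mabs : measurable_fun setT (fun x : R => `|x|%:E).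
    by apply/measurable_EFinP; exact: normr_measurable.
  apply: (@le_lt_trans _ _ (\int[mu]_x (`|x|%:E + `|c|%:E))%E).
    apply: ge0_le_integral => //.
    - by move=> x _; rewrite lee_fin.
    - exact/measurable_EFinP.
    - by apply: emeasurable_funD.
    - move=> x _; rewrite -EFinD lee_fin /g ge_max addr_ge0// andbT.
      by rewrite -[X in _ <= X + _]/(`|x|) (le_trans (ler_norm _))// ler_normB.
  rewrite ge0_integralD// integral_cst//= probability_setT mule1.
  by rewrite lte_add_pinfty// ltry.
(* Compare tails: for [r >= 0], [V] or [W] exceeds [r] exactly when [X0] or the midpoint [M] exceeds
   [c + r / 2], and the class property with weights one half applies. *)
have VW : (\int[P]_w (V w)%:E <= \int[P]_w (W w)%:E)%E.
  have := @ge0_expectation_ccdf _ _ _ P (mfun_of mV)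
    (fun w => addr_ge0 (g0 _) (g0 _)).
  rewrite expectation_def => ->.
  have := @ge0_expectation_ccdf _ _ _ P (mfun_of mW) W0.
  rewrite expectation_def => ->.
  apply: ge0_le_integral => //.
  - exact: measurable_funTS (@ccdf_measurable _ _ _ _ _).
  - exact: measurable_funTS (@ccdf_measurable _ _ _ _ _).
  move=> r; rewrite /= in_itv/= andbT => r0.
  rewrite /ccdf /distribution /pushforward.
  pose t := c + r / 2.
  pose M w := \sum_(i < 2) (2^-1 : R) * X i w.
  have mM : measurable_fun setT M by exact: measurable_wsum.
  have VE w : (r < V w) = (t < X0 w).
    by rewrite /V /g /t; case: (ltP (X0 w - c) 0) => ?; apply/idP/idP => ?; lra.
  have WE w : (r < W w) = (t < M w).
    have -> : M w = (X0 w + X1 w) / 2.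
      rewrite /M !big_ord_recl big_ord0 addr0 -mulrDr mulrC.
      by congr ((_ + X _ w) / _); exact: val_inj.
    by rewrite /W /t; case: (ltP (X0 w + X1 w - 2 * c) 0) => ?;
      apply/idP/idP => ?; lra.
  have -> : mfun_of mV @^-1` `]r, +oo[ = ~` [set w | X ord0 w <= t].
    by apply/seteqP; split=> w; rewrite /= in_itv/= andbT VE ltNge => /negP.
  have -> : mfun_of mW @^-1` `]r, +oo[ = ~` [set w | M w <= t].
    by apply/seteqP; split=> w; rewrite /= in_itv/= andbT WE ltNge => /negP.
  rewrite !probability_setC; [|exact: measurable_Iic..].
  apply: leeB => //; apply: (Dmu (theta := fun=> 2^-1) _ _ iidX t) => //.
  by rewrite !big_ord_recl big_ord0/=; lra.
have sumE (f1 f2 : T -> R) : measurable_fun setT f1 -> measurable_fun setT f2 ->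
    (forall w, 0 <= f1 w) -> (forall w, 0 <= f2 w) ->
    (\int[P]_w (f1 w + f2 w)%:E = \int[P]_w (f1 w)%:E + \int[P]_w (f2 w)%:E)%E.
  move=> mf1 mf2 f10 f20; under eq_integral do rewrite EFinD.
  by apply: ge0_integralD => // [w _||w _|]; rewrite ?lee_fin//;
    exact/measurable_EFinP.
have VE : (\int[P]_w (V w)%:E = e + e)%E.
  by rewrite sumE ?eE//; exact: mgX.
have WGE : (\int[P]_w (W w)%:E + \int[P]_w (G w)%:E = e + e)%E.
  rewrite -sumE// -[X in (X + _)%E](eE ord0) -[X in (_ + X)%E](eE ord_max)
    -sumE//; [|exact: mgX..].
  by apply: eq_integral => w _; rewrite /G addrC subrK.
(* The finite mean enters here: [e + e] can be cancelled. *)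
have intG : (\int[P]_w (G w)%:E = 0)%E.
  apply/eqP; rewrite eq_le; apply/andP; split; last first.
    by apply: integral_ge0 => w _; rewrite lee_fin.
  have eefin : (e + e)%E \is a fin_num by rewrite fin_numD efin.
  rewrite -(leeD2lE _ _ eefin) adde0 -[leRHS]WGE -VE.
  by apply: leeD.
have aeG : ae_eq P setT (EFin \o G) (cst 0%E).
  apply/(ae_eq_integral_abs P measurableT); first exact/measurable_EFinP.
  by rewrite -[RHS]intG; apply: eq_integral => w _ /=; rewrite ger0_norm.
(* When [c] separates [X0 w] from [X1 w], the gap [G w] is the smaller of [c - X0 w] and [X1 w - c],
   hence positive. *)
have : P ([set w | X0 w < c] `&` [set w | c < X1 w]) = 0%E.
  apply/negligibleP.
    apply: measurableI; last exact: measurable_Ioi.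
    have -> : [set w | X0 w < c] = X0 @^-1` `]-oo, c[ by rewrite set_itvNyo.
    exact: measurable_funPTI.
  apply: negligibleS aeG => w [/= X0c cX1] /(_ I) [].
  rewrite /G /W /g; move: X0c cX1.
  by case: (ltP (X0 w - c) 0); case: (ltP (X1 w - c) 0);
    case: (ltP (X0 w + X1 w - 2 * c) 0); lra.
pose B (i : 'I_2) := if i == ord0 then Iio c else Ioi c.
have mB i : measurable (B i).
  by rewrite /B; case: eqP => _; rewrite -?set_itvNyo -?set_itvoy.
have -> : [set w | X0 w < c] `&` [set w | c < X1 w] =
    \bigcap_(i in [set: 'I_2]) (X i @^-1` B i).
  apply/seteqP; split=> [w [h0 h1] i _|w h].
    rewrite /B; case: eqP => [->//|]; case: i => -[|[|//]] i2 ine.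
      by case: ine; exact: val_inj.
    by rewrite (_ : Ordinal i2 = ord_max)//; exact: val_inj.
  by split; [exact: (h ord0 I)|exact: (h ord_max I)].
rewrite iidX.1// !big_ord_recl big_ord0 mule1 !iidX.2// => /eqP.
by rewrite mule_eq0 => /orP[] /eqP; [left|right].
Qed.

End infinite_mean.

Lemma Dminus_infinite_mean (R : realType) d (T : measurableType d)
    (P : probability T R) (X : {RV P >-> R}) :
  Dminus (distribution P X) -> ~ (exists c : R, P [set w | X w = c] = 1%E) ->
  (\int[P]_w (`|X w|)%:E = +oo)%E.
Proof.
move=> DX ndeg; apply/eqP; rewrite -leye_eq leNgt; apply/negP => fin.
apply: ndeg; apply: (degenerate_of_sides (mu := distribution P X)) => c.
apply: sides_null => //.
rewrite ge0_integral_distribution//.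
by apply/measurable_EFinP; exact: normr_measurable.
Qed.

Theorem theorem2 (R : realType) :
  (* (a) closure under convergence in distribution *)
  (forall (mu_ : nat -> probability R R) (mu : probability R R),
      (forall k, Dminus (mu_ k)) -> cvg_in_distribution mu_ mu -> Dminus mu) /\
  (* (b) non-degenerate members have infinite mean absolute value *)
  (forall (d : measure_display) (T : measurableType d) (P : probability T R)
      (X : {RV P >-> R}),
      Dminus (distribution P X) ->
      ~ (exists c : R, P [set w | X w = c] = 1%E) ->
      (\int[P]_w (`|X w|)%:E = +oo)%E) /\
  (* (c) positive affine transformations *)
  (forall (d : measure_display) (T : measurableType d) (P : probability T R)
      (X Z : {RV P >-> R}) (a b : R),
      Dminus (distribution P X) -> 0 < a ->
      (forall w, Z w = a * X w + b) -> Dminus (distribution P Z)) /\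
  (* (d) sums of independent members *)
  (forall (d : measure_display) (T : measurableType d) (P : probability T R)
      (X Y Z : {RV P >-> R}),
      Dminus (distribution P X) -> Dminus (distribution P Y) ->
      independent2 X Y ->
      (forall w, Z w = X w + Y w) -> Dminus (distribution P Z)) /\
  (* (e) maxima of independent members *)
  (forall (d : measure_display) (T : measurableType d) (P : probability T R)
      (X Y Z : {RV P >-> R}),
      Dminus (distribution P X) -> Dminus (distribution P Y) ->
      independent2 X Y ->
      (forall w, Z w = Num.max (X w) (Y w)) -> Dminus (distribution P Z)) /\
  (* (f) non-decreasing convex transformations *)
  (forall (d : measure_display) (T : measurableType d) (P : probability T R)
      (X Z : {RV P >-> R}) (phi : R -> R),
      Dminus (distribution P X) ->
      (forall x y : R, x <= y -> phi x <= phi y) ->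
      (forall (x y l : R), 0 <= l -> l <= 1 ->
          phi (l * x + (1 - l) * y) <= l * phi x + (1 - l) * phi y) ->
      (forall w, Z w = phi (X w)) -> Dminus (distribution P Z)).
Proof.
split; first exact: Dminus_weak_limit.
split; first exact: Dminus_infinite_mean.
split.
  move=> d T P X Z a b DX a0 ZE.
  apply: (Dminus_convex (phi := fun x => a * x + b) _ _ DX) => // [x y xy|x y l _ _].
    by rewrite lerD2r ler_pM2l.
  by rewrite le_eqVlt; apply/orP; left; apply/eqP; ring.
split; first by move=> d T P X Y Z; exact: Dminus_add.
split; first by move=> d T P X Y Z; exact: Dminus_max.
by move=> d T P X Z phi DX nd cv; exact: Dminus_convex.
Qed.
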